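(* Let $\Gamma=(\mathbb V,E)$ be a connected graph with countably infinite vertex set and uniformly bounded vertex degrees, and let $H$ be a Jacobi operator on $\Gamma$ (as defined in the context). For any nonempty finite subset $A\subset\mathbb V$, let $H_A$ be the Dirichlet restriction of $H$ to $A$, $\lambda_A>0$ its smallest eigenvalue and $u_A$ its landscape function. Then $$\lambda_A\|u_A\|_{\ell^\infty(A)}\ge1.$$
   Context: Graphs are simple (no loops or multiple edges); $x\sim y$ means $\{x,y\}\in E$; $\deg(x)=\#\{y:y\sim x\}$. Jacobi operator: for $f:\mathbb V\to\mathbb R$, $$Hf(x)=\frac1{\deg(x)}\sum_{y:y\sim x}\big(f(x)-a(x,y)f(y)\big)+V(x)f(x),$$ where $V:\mathbb V\to[0,\infty)$, and $a(x,y)=a(y,x)\in[0,1]$ if $x\sim y$, $a(x,y)=0$ otherwise. Dirichlet restriction: for $x\in A$ and $f:A\to\mathbb R$, $H_Af(x)=f(x)-\frac1{\deg(x)}\sum_{y\in A:\,y\sim x}a(x,y)f(y)+V(x)f(x)$, with $\deg(x)$ the degree in the full graph $\Gamma$. For finite nonempty $A$, $H_A$ is self-adjoint and strictly positive on $\ell^2(A)$ with the weighted inner product $(f,g)_\mu=\sum_{x\in A}f(x)g(x)\deg(x)$. The landscape function $u_A:A\to\mathbb R$ is the unique solution of $H_Au_A(x)=1$ for all $x\in A$. *)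

(* Defs.v *)
From HB Require Import structures.
From mathcomp Require Import all_boot all_order all_algebra finmap.
From mathcomp Require Import boolp classical_sets functions cardinality reals.
From mathcomp Require Import ring.

Set Implicit Arguments.
Unset Strict Implicit.
Unset Printing Implicit Defensive.

Import Order.TTheory GRing.Theory Num.Theory.
Local Open Scope classical_set_scope.
Local Open Scope fset_scope.
Local Open Scope ring_scope.

Section Graph.
Context {V : choiceType}.
Implicit Types (e : rel V) (x y : V).

Definition simple_graph e : Prop := symmetric e /\ irreflexive e.

Definition connected_graph e : Prop :=
  forall x y, exists2 p : seq V, path e x p & last x p = y.

(* [fset_set] returns the empty set on infinite sets, so [nbrs] and [deg] are
   meaningful only for locally finite graphs; [bounded_degree] therefore
   requires finiteness of every neighbourhood explicitly. *)
Definition nbrs e x : {fset V} := fset_set [set y | e x y].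

Definition deg e x : nat := #|` nbrs e x|.

Definition bounded_degree e : Prop :=
  exists D : nat, forall x, finite_set [set y | e x y] /\ (deg e x <= D)%N.

End Graph.

Section Jacobi.
Context {R : realType} {V : choiceType}.
Variables (e : rel V) (a : V -> V -> R) (W : V -> R).

Definition jacobi_coeffs : Prop :=
  [/\ forall x, 0 <= W x,
      forall x y, a x y = a y x,
      forall x y, e x y -> 0 <= a x y <= 1
    & forall x y, ~~ e x y -> a x y = 0].

Definition jacobi (f : V -> R) (x : V) : R :=
  (deg e x)%:R^-1 * (\sum_(y <- nbrs e x) (f x - a x y * f y)) + W x * f x.

Variable A : {fset V}.

(* The degree is taken in the full graph, not in the subgraph induced on A. *)
Definition dirichlet_fun (f : {ffun A -> R^o}) : {ffun A -> R^o} :=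
  [ffun x : A => f x
     - (deg e (val x))%:R^-1
       * (\sum_(y : A | e (val x) (val y)) a (val x) (val y) * f y)
     + W (val x) * f x].

Lemma dirichlet_fun_linear : linear dirichlet_fun.
Proof.
move=> k f g; apply/ffunP => x; rewrite !ffunE.
under eq_bigr => y _ do rewrite !ffunE.
rewrite (eq_bigr (fun y : A => k * (a (val x) (val y) * f y)
    + a (val x) (val y) * g y)); last first.
  by move=> y _; rewrite mulrDr mulrCA.
rewrite big_split /= -mulr_sumr /GRing.scale /=.
set S := \sum_(y : A | _) _; set T := \sum_(y : A | _) _.
by set c := _^-1; ring.
Qed.

HB.instance Definition _ :=
  GRing.isLinear.Build R {ffun A -> R^o} {ffun A -> R^o} _ dirichlet_fun
    dirichlet_fun_linear.

Definition dirichlet : 'End({ffun A -> R^o}) := linfun dirichlet_fun.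

Lemma dirichletE (f : {ffun A -> R^o}) (x : A) :
  dirichlet f x = f x
     - (deg e (val x))%:R^-1
       * (\sum_(y : A | e (val x) (val y)) a (val x) (val y) * f y)
     + W (val x) * f x.
Proof. by rewrite lfunE /= ffunE. Qed.

Lemma dirichlet_eigenvalueP (lambda : R) :
  passmx.leigenvalue dirichlet lambda <->
  exists2 f : {ffun A -> R^o}, f != 0 & dirichlet f = lambda *: f.
Proof.
rewrite /passmx.leigenvalue /passmx.leigenspace; split=> [nz|[f f0 Hf]].
  exists (vpick (lker (dirichlet - lambda *: \1%VF))); first by rewrite vpick0.
  have := memv_pick (lker (dirichlet - lambda *: \1%VF)).
  by rewrite memv_ker add_lfunE opp_lfunE scale_lfunE id_lfunE subr_eq0 => /eqP.
apply: contraNneq f0 => k0; rewrite -memv0 -k0 memv_ker.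
by rewrite add_lfunE opp_lfunE scale_lfunE id_lfunE Hf subrr.
Qed.

(* [dirichlet] is the compression of [jacobi] to functions extended by zero
   outside A. *)
Lemma jacobi_dirichlet (f : {ffun A -> R^o}) (x : A) :
  finite_set [set y | e (val x) y] -> (0 < deg e (val x))%N ->
  jacobi (fun v => if insub v is Some y then f y else 0) (val x)
  = dirichlet f x.
Proof.
move=> fin dx; rewrite dirichletE /jacobi valK; congr (_ + _).
rewrite big_split /= sumrN mulrDr mulrN; congr (_ - _).
  rewrite big_const_seq count_predT iter_addr_0 -/(deg e (val x)).
  by rewrite -[f x *+ _]mulr_natl mulrA mulVf ?mul1r // pnatr_eq0 -lt0n.
congr (_ * _); rewrite (bigID (mem A)) /= [X in _ + X]big1 ?addr0; last first.
  by move=> y yA; rewrite insubN ?mulr0.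
transitivity (\sum_(y <- A | e (val x) y)
    a (val x) y * (if insub y is Some z then f z else 0)); last first.
  by rewrite big_seq_fsetE /=; apply: eq_bigr => y _; rewrite valK.
rewrite -[LHS]big_filter -[RHS]big_filter; apply: perm_big.
apply: uniq_perm; rewrite ?filter_uniq ?fset_uniq // => y.
rewrite !mem_filter [in LHS]andbC in_fset_set //; congr (_ && _).
by apply/idP/idP => [/set_mem|?]; last exact: mem_set.
Qed.

Definition smallest_eigenvalue (lambda : R) : Prop :=
  passmx.leigenvalue dirichlet lambda
  /\ forall mu : R, passmx.leigenvalue dirichlet mu -> lambda <= mu.

Definition landscape (u : {ffun A -> R^o}) : Prop :=
  forall x : A, dirichlet u x = 1.

End Jacobi.

Definition sup_norm {R : realType} {T : finType} (f : {ffun T -> R^o}) : R :=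
  \big[Order.max/0]_(x : T) `|f x|.

(* Main.v *)
(** Let [f] be an eigenfunction for [lambda]. The triangle inequality gives
    [H_A |f| <= lambda |f| <= lambda M = H_A (lambda M u)] with [M = max |f|],
    so the comparison principle for [H_A] yields [|f| <= lambda M u]; evaluate
    this where [|f| = M]. The comparison principle holds because a negative
    minimum of [v] with [H v >= 0] propagates to all neighbours, hence to all
    of the infinite connected graph, whereas functions on [A] extended by zero
    vanish off a finite set. *)

Require Import Defs.
From mathcomp Require Import all_boot all_order all_algebra finmap.
From mathcomp Require Import boolp classical_sets functions cardinality reals.
From mathcomp Require Import lra.

Import Order.TTheory GRing.Theory Num.Theory.

Local Open Scope classical_set_scope.
Local Open Scope card_scope.
Local Open Scope fset_scope.
Local Open Scope ring_scope.

Lemma in_nbrs (V : choiceType) (e : rel V) (x y : V) :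
  finite_set [set z | e x z] -> (y \in nbrs e x) = e x y.
Proof.
move=> fin; rewrite /nbrs in_fset_set //.
by apply/idP/idP => [/set_mem|?]; last exact: mem_set.
Qed.

(** A nonempty path from [x] starts at a neighbour of [x], so an isolated vertex would be the whole
    graph. Positivity makes [(deg e x)%:R^-1] a genuine inverse. *)
Lemma connected_deg_gt0 (V : choiceType) (e : rel V) :
  infinite_set [set: V] -> connected_graph e -> bounded_degree e ->
  forall x, (0 < deg e x)%N.
Proof.
move=> infV conn [D bnd] x; have [fin _] := bnd x.
rewrite lt0n; apply/negP => /eqP d0; apply: infV.
apply: (@sub_finite_set _ _ [set x]); last exact: finite_set1.
move=> y _ /=; have [[|z p] /=] := conn x y; first by move=> _ ->.
by case/andP; rewrite -in_nbrs // (cardfs0_eq d0) in_fset0.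
Qed.

Section JacobiPrinciples.
Context {R : realType} {V : choiceType}.
Variables (e : rel V) (a : V -> V -> R) (W : V -> R).
Hypotheses (infV : infinite_set [set: V]) (conn : connected_graph e).
Hypotheses (bnd : bounded_degree e) (aW : jacobi_coeffs e a W).

Let fin x : finite_set [set y | e x y].
Proof. by case: bnd => D /(_ x) []. Qed.

Let deg_gt0 : forall x, (0 < deg e x)%N.
Proof. exact: connected_deg_gt0. Qed.

Let W_ge0 x : 0 <= W x.
Proof. by case: aW. Qed.

Let a_ge0 x y : 0 <= a x y.
Proof.
case: aW => _ _ a01 a0; have [/a01/andP[]//|/a0->//] := boolP (e x y).
Qed.

Let a_le1 x y : a x y <= 1.
Proof.
case: aW => _ _ a01 a0; have [/a01/andP[]//|/a0->] := boolP (e x y).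
exact: ler01.
Qed.

Lemma jacobi_ge0_at_max (v : V -> R) (x : V) :
  (forall y, 0 <= v y) -> (forall y, v y <= v x) -> 0 <= jacobi e a W v x.
Proof.
move=> v0 vmax; rewrite /jacobi addr_ge0 ?mulr_ge0 ?invr_ge0 ?ler0n //.
apply: sumr_ge0 => y _; rewrite subr_ge0.
by rewrite (le_trans _ (vmax y)) // ler_piMl.
Qed.

(** At a negative minimum, [v x <= a x z * v x <= a x z * v z], so every term of the sum is
    nonpositive, as is the potential term. Nonnegativity of the total then forces each term to
    vanish. *)
Lemma negative_min_nbr (v : V -> R) (x y : V) :
  0 <= jacobi e a W v x -> v x < 0 -> (forall z, v x <= v z) ->
  e x y -> v y = v x.
Proof.
move=> Hx vx0 vmin exy.
have term_le0 z : v x - a x z * v z <= 0.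
  have := vmin z; have := a_ge0 x z; have := a_le1 x z; nra.
have sum_ge0 : 0 <= \sum_(z <- nbrs e x) (v x - a x z * v z).
  have c0 : 0 < (deg e x)%:R^-1 :> R by rewrite invr_gt0 ltr0n.
  move: Hx; rewrite /jacobi => Hx.
  have := W_ge0 x; nra.
have term_eq0 : v x - a x y * v y = 0.
  apply/eqP; rewrite -oppr_eq0 eq_le oppr_ge0 term_le0 andbT.
  apply: le_trans (_ : \sum_(z <- nbrs e x) - (v x - a x z * v z) <= 0).
    rewrite (big_fsetD1 y) ?in_nbrs //= lerDl.
    by apply: sumr_ge0 => z _; rewrite oppr_ge0.
  by rewrite sumrN oppr_le0.
(* From [v x = a x y * v y] with [v x < 0], the value [v y] is negative; then [a x y <= 1] gives
   [v y <= v x]. *)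
have vy_lt0 : v y < 0 by have := a_ge0 x y; nra.
by apply/eqP; rewrite eq_le vmin andbT; have := a_le1 x y; nra.
Qed.

(** Induction along a path: each neighbour of a minimum point is again one. The sign condition is
    asked only where [v] is negative, so that it holds vacuously off [A] for a zero extension. *)
Lemma negative_min_constant (v : V -> R) (x : V) :
  (forall y, v y < 0 -> 0 <= jacobi e a W v y) -> v x < 0 ->
  (forall z, v x <= v z) -> forall y, v y = v x.
Proof.
move=> Hv vx0 vmin y; have [p + <-] := conn x y.
elim: p x vx0 vmin => [//|z p IHp] x vx0 vmin /= /andP[exz pzp].
have vzx : v z = v x by apply: negative_min_nbr => //; exact: Hv.
by rewrite -vzx; apply: IHp; rewrite ?vzx.
Qed.

Variable A : {fset V}.
Implicit Types f g v : {ffun A -> R^o}.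

Definition zero_ext f (x : V) : R := if insub x is Some y then f y else 0.

Lemma zero_ext_val f (x : A) : zero_ext f (val x) = f x.
Proof. by rewrite /zero_ext valK. Qed.

Lemma zero_ext_out f (x : V) : x \notin A -> zero_ext f x = 0.
Proof. by move=> xA; rewrite /zero_ext insubN. Qed.

Lemma jacobi_zero_ext f (x : A) :
  jacobi e a W (zero_ext f) (val x) = dirichlet e a W A f x.
Proof. exact: jacobi_dirichlet. Qed.

Lemma dirichlet_comparison v :
  (forall x, 0 <= dirichlet e a W A v x) -> forall x, 0 <= v x.
Proof.
move=> Hv x1; rewrite leNgt; apply/negP => vx1.
case: (@arg_minP _ _ _ x1 xpredT (fun x => v x : R) isT) => x _ xmin.
have vx0 : zero_ext v (val x) < 0.
  by rewrite zero_ext_val; exact: le_lt_trans (xmin x1 isT) vx1.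
(* A vertex outside [A] would carry both the value 0 and the negative minimum, so [A] would be all
   of [V]. *)
apply: infV; apply: (@sub_finite_set _ _ [set` A]); last exact: finite_fset.
move=> y _ /=; apply/negPn/negP => yA.
suff vyx : zero_ext v y = zero_ext v (val x).
  by move: vx0; rewrite -vyx zero_ext_out // ltxx.
apply: (negative_min_constant _ _ _ vx0) => {yA}y; have [yA|yA] := boolP (y \in A).
- by move=> _; rewrite (_ : y = val [` yA]) // jacobi_zero_ext.
- by rewrite zero_ext_out // ltxx.
- by rewrite (_ : y = val [` yA]) // !zero_ext_val xmin.
- by rewrite (zero_ext_out v y yA) ltW.
Qed.

Lemma dirichlet_abs_le (lambda : R) f :
  dirichlet e a W A f = lambda *: f ->
  forall x, dirichlet e a W A [ffun y => `|f y|] x <= lambda * `|f x|.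
Proof.
move=> Hf x.
have: dirichlet e a W A f x = lambda * f x by rewrite Hf ffunE.
rewrite !dirichletE ffunE.
set S := \sum_(y | _) _; set T := \sum_(y | _) _ => Hx.
have ST : `|S| <= T.
  apply: le_trans (ler_norm_sum _ _ _) _; apply: ler_sum => y _.
  by rewrite ffunE normrM (ger0_norm (a_ge0 _ _)).
set c := _^-1 in Hx *.
have cST : `|c * S| <= c * T.
  by rewrite normrM ger0_norm ?ler_wpM2l // invr_ge0 ler0n.
(* The factor may be negative; bounding it by its absolute value avoids a case split. *)
have key : (1 + W (val x) - lambda) * `|f x| <= `|c * S|.
  have -> : c * S = (1 + W (val x) - lambda) * f x by lra.
  by rewrite normrM ler_wpM2r ?ler_norm.
lra.
Qed.

Lemma eigenvalue_landscape_ge1 (lambda : R) (u : {ffun A -> R^o}) :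
  passmx.leigenvalue (dirichlet e a W A) lambda -> landscape e a W u ->
  1 <= lambda * sup_norm u.
Proof.
move=> /dirichlet_eigenvalueP[f f0 Hf] Hu.
have [x1 fx1] : exists x, f x != 0.
  apply/existsP; apply: contraNT f0; rewrite negb_exists => /forallP fz.
  by apply/eqP/ffunP => x; rewrite ffunE; apply/eqP/negPn/fz.
case: (@arg_maxP _ _ _ x1 xpredT (fun x => `|f x| : R) isT) => x _ xmax.
have M_gt0 : 0 < `|f x|.
  by apply: lt_le_trans (xmax x1 isT); rewrite normr_gt0.
pose g : {ffun A -> R^o} := [ffun y => `|f y|].
have Hg := dirichlet_abs_le _ _ Hf.
(* At the maximum point [x] of [|f|], the Jacobi operator applied to the extended [|f|] is
   nonnegative and at most [lambda * |f x|]. *)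
have lambda_ge0 : 0 <= lambda.
  rewrite -(pmulr_lge0 _ M_gt0); apply: le_trans (Hg x).
  rewrite -jacobi_zero_ext; apply: jacobi_ge0_at_max => y;
    have [yA|yA] := boolP (y \in A).
  - by rewrite (_ : y = val [` yA]) // zero_ext_val ffunE.
  - by rewrite zero_ext_out.
  - by rewrite (_ : y = val [` yA]) // !zero_ext_val !ffunE; exact: xmax.
  - by rewrite (zero_ext_out _ y yA) zero_ext_val ffunE.
have f_le y : `|f y| <= lambda * `|f x| * u y.
  have: 0 <= ((lambda * `|f x|) *: u - g) y; last first.
    by rewrite !ffunE subr_ge0.
  apply: dirichlet_comparison => z.
  rewrite linearB linearZ !ffunE Hu subr_ge0.
  apply: le_trans (Hg z) _.
  by rewrite [_ *: _]mulr1; apply: ler_wpM2l => //; exact: xmax.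
have u_le : u x <= sup_norm u.
  apply: le_trans (ler_norm _) _; rewrite /sup_norm.
  exact: (le_bigmax _ (fun y => `|u y| : R)).
apply: le_trans (_ : lambda * u x <= _); last by rewrite ler_wpM2l.
(* This is [f_le] at [y = x], divided by [|f x|]. *)
by rewrite -(ler_pM2r M_gt0) mul1r mulrAC.
Qed.

End JacobiPrinciples.

Theorem proposition1 (R : realType) (V : choiceType) (e : rel V)
    (a : V -> V -> R) (W : V -> R)
    (V_countably_infinite : [set: V] #= [set: nat])
    (e_simple : simple_graph e)
    (e_connected : connected_graph e)
    (e_bounded : bounded_degree e)
    (aW_jacobi : jacobi_coeffs e a W)
    (A : {fset V}) (A_nonempty : A != fset0)
    (lambda : R) (lambda_min : smallest_eigenvalue e a W A lambda)
    (u : {ffun A -> R^o}) (u_landscape : landscape e a W u) :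
  1 <= lambda * sup_norm u.
Proof.
have infV : infinite_set [set: V].
  by apply/infiniteP; move: V_countably_infinite; rewrite card_eq_le => /andP[].
case: lambda_min => lambda_eigen _.
exact: eigenvalue_landscape_ge1 lambda_eigen u_landscape.
Qed.
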